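(* Let $p$ be a prime and let $G$ be a finite group with center $Z(G)$ such that $G/Z(G)\cong\mathbb Z_p\times\mathbb Z_p$, and let $\Gamma_G$ be its non-commuting graph. Then: (a) $E(\Gamma_G)=LE(\Gamma_G)=LE^+(\Gamma_G)$. (b) $\Gamma_G$ is not hypoenergetic, not hyperenergetic, not L-hyperenergetic and not Q-hyperenergetic. In particular, if $G$ is a non-abelian group with $|G|=p^3$, then $E(\Gamma_G)=LE(\Gamma_G)=LE^+(\Gamma_G)$ and $\Gamma_G$ is not hyperenergetic, not hypoenergetic, not L-hyperenergetic and not Q-hyperenergetic.
   Context: For a finite non-abelian group $G$ with center $Z(G)$, the non-commuting graph $\Gamma_G$ is the simple undirected graph with vertex set $G\setminus Z(G)$ in which $x,y$ are adjacent iff $xy\ne yx$. For a finite simple graph $\mathcal G$ with vertex set $v(\mathcal G)$, edge set $e(\mathcal G)$, adjacency matrix $A(\mathcal G)$ and diagonal degree matrix $D(\mathcal G)$, put $L(\mathcal G)=D(\mathcal G)-A(\mathcal G)$ (Laplacian) and $Q(\mathcal G)=D(\mathcal G)+A(\mathcal G)$ (signless Laplacian). With sums over eigenvalues counted with multiplicity, define $E(\mathcal G)=\sum_{\lambda}|\lambda|$ ($\lambda$ eigenvalues of $A(\mathcal G)$), $LE(\mathcal G)=\sum_{\beta}\left|\beta-\frac{2|e(\mathcal G)|}{|v(\mathcal G)|}\right|$ ($\beta$ eigenvalues of $L(\mathcal G)$), $LE^+(\mathcal G)=\sum_{\gamma}\left|\gamma-\frac{2|e(\mathcal G)|}{|v(\mathcal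 G)|}\right|$ ($\gamma$ eigenvalues of $Q(\mathcal G)$). With $K_n$ the complete graph on $n$ vertices, $\mathcal G$ is called hyperenergetic if $E(\mathcal G)>E(K_{|v(\mathcal G)|})$, hypoenergetic if $E(\mathcal G)<|v(\mathcal G)|$, L-hyperenergetic if $LE(\mathcal G)>LE(K_{|v(\mathcal G)|})$, and Q-hyperenergetic if $LE^+(\mathcal G)>LE^+(K_{|v(\mathcal G)|})$. *)

(* Defs.v *)
From mathcomp Require Import all_boot all_order all_algebra all_fingroup all_solvable all_field.
Set Implicit Arguments.
Unset Strict Implicit.
Unset Printing Implicit Defensive.

Import Order.TTheory GRing.Theory Num.Theory GroupScope.
Local Open Scope ring_scope.

Record sgraph := SGraph {
  vertex : finType;
  adj : rel vertex;
  adj_sym : symmetric adj;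
  adj_irr : irreflexive adj
}.

Definition edges (g : sgraph) : {set {set vertex g}} :=
  [set [set xy.1; xy.2] | xy : vertex g * vertex g & adj xy.1 xy.2].

Definition degree (g : sgraph) (x : vertex g) : nat := #|[set y | adj x y]|.

(* The matrices have integer entries, so their eigenvalues are algebraic and
   can be taken in algC.  Rows and columns are indexed through the standard
   enumeration of the vertices. *)
Definition adjmx (g : sgraph) : 'M[algC]_#|vertex g| :=
  \matrix_(i, j) (adj (enum_val i) (enum_val j))%:R.

Definition degmx (g : sgraph) : 'M[algC]_#|vertex g| :=
  diag_mx (\row_i (degree (enum_val i))%:R).

Definition lapmx (g : sgraph) : 'M[algC]_#|vertex g| := degmx g - adjmx g.

Definition slapmx (g : sgraph) : 'M[algC]_#|vertex g| := degmx g + adjmx g.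

(* The roots of the characteristic polynomial, each listed with its algebraic
   multiplicity; the order of the list is immaterial. *)
Definition eigenvalues (n : nat) (A : 'M[algC]_n) : seq algC :=
  sval (closed_field_poly_normal (char_poly A)).

Definition avg_degree (g : sgraph) : algC :=
  (2 * #|edges g|)%:R / #|vertex g|%:R.

Definition energy (g : sgraph) : algC :=
  \sum_(l <- eigenvalues (adjmx g)) `|l|.

Definition lap_energy (g : sgraph) : algC :=
  \sum_(b <- eigenvalues (lapmx g)) `|b - avg_degree g|.

Definition slap_energy (g : sgraph) : algC :=
  \sum_(c <- eigenvalues (slapmx g)) `|c - avg_degree g|.

Definition complete_rel (n : nat) : rel 'I_n := fun i j => i != j.

Lemma complete_sym (n : nat) : symmetric (@complete_rel n).
Proof. by move=> i j; rewrite /complete_rel eq_sym. Qed.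

Lemma complete_irr (n : nat) : irreflexive (@complete_rel n).
Proof. by move=> i; rewrite /complete_rel eqxx. Qed.

Definition complete_graph (n : nat) : sgraph :=
  SGraph (@complete_sym n) (@complete_irr n).

(* The order of algC is partial, but energies are sums of norms, so the
   comparisons below are between real numbers. *)
Definition hyperenergetic (g : sgraph) : Prop :=
  energy g > energy (complete_graph #|vertex g|).

Definition hypoenergetic (g : sgraph) : Prop :=
  energy g < #|vertex g|%:R.

Definition L_hyperenergetic (g : sgraph) : Prop :=
  lap_energy g > lap_energy (complete_graph #|vertex g|).

Definition Q_hyperenergetic (g : sgraph) : Prop :=
  slap_energy g > slap_energy (complete_graph #|vertex g|).

Section NonCommutingGraph.
Variables (gT : finGroupType) (G : {group gT}).

Definition noncentral : finType := {x : gT | x \in G :\: 'Z(G)}.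

Definition noncomm_rel : rel noncentral :=
  fun x y => (val x * val y)%g != (val y * val x)%g.

Lemma noncomm_sym : symmetric noncomm_rel.
Proof. by move=> x y; rewrite /noncomm_rel eq_sym. Qed.

Lemma noncomm_irr : irreflexive noncomm_rel.
Proof. by move=> x; rewrite /noncomm_rel eqxx. Qed.

Definition noncommuting_graph : sgraph := SGraph noncomm_sym noncomm_irr.

End NonCommutingGraph.

(* Main.v *)
(* If [G : Z(G)] = p^2, the centralizer of a noncentral x is abelian and has
   index p over Z(G).  Commuting is thus an equivalence relation on G \ Z(G),
   so the graph is complete multipartite, with p + 1 parts of size
   m = (p - 1)|Z(G)|.  For such a graph with n vertices A^2 = (n - m) J - m A
   and AJ = (n - m) J, so the eigenvalues of A lie in {0, -m, n - m}; on this
   set |l| = a l + b l^2 with b = 2 / n, and tr A = 0, tr A^2 = n (n - m) give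
   E = 2 (n - m) without computing multiplicities.  The complete graph is the
   case m = 1.  Since these graphs are k-regular, L = k - A and Q = k + A, and
   the three energies agree. *)
Require Import Defs.
From mathcomp Require Import all_boot all_order all_algebra all_fingroup all_solvable all_field.
From mathcomp Require Import spectral sesquilinear ring.
Set Implicit Arguments.
Unset Strict Implicit.
Unset Printing Implicit Defensive.

Import Order.TTheory GRing.Theory Num.Theory GroupScope.
Local Open Scope ring_scope.

(** * Similarity and sums over eigenvalues *)

(** Over the polynomial ring, [P] intertwines the two characteristic matrices, and its determinant
    is a nonzero constant that cancels. *)
Lemma char_poly_simmx (F : fieldType) (n : nat) (P A B : 'M[F]_n) :
  P \in unitmx -> P *m A = B *m P -> char_poly A = char_poly B.
Proof.
rewrite unitmxE unitfE => Pu eqPA; pose f := @polyC F.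
have detP : \det (map_mx f P) != 0 by rewrite det_map_mx polyC_eq0.
apply: (mulfI detP); rewrite [RHS]mulrC -!det_mulmx /char_poly_mx.
by rewrite mulmxBr mulmxBl -!map_mxM eqPA -scalar_mxC.
Qed.

(** Factorization into monic linear factors is unique up to order, so the chosen list of roots is a
    permutation of the diagonal [d]. *)
Lemma sum_eigenvalues_diag (n : nat) (A P : 'M[algC]_n) (d : 'rV_n)
    (f : algC -> algC) :
  P \in unitmx -> A = invmx P *m diag_mx d *m P ->
  \sum_(l <- eigenvalues A) f l = \sum_i f (d 0 i).
Proof.
move=> Pu defA.
have charA :
    char_poly A = \prod_(z <- [seq d 0 i | i <- enum 'I_n]) ('X - z%:P).
  have -> : char_poly A = char_poly (diag_mx d).
    apply: (char_poly_simmx Pu); rewrite defA mulmxA mulmxA.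
    by rewrite mulmxV // mul1mx.
  rewrite char_poly_trig ??diag_mx_is_trig // big_map big_enum.
  by apply: eq_bigr => i _; rewrite mxE eqxx.
rewrite /eigenvalues; case: closed_field_poly_normal => s /= def_s.
rewrite (perm_big [seq d 0 i | i <- enum 'I_n]) /=; last first.
  apply: prod_XsubC_eq; rewrite -charA [RHS]def_s.
  by rewrite (monicP (char_poly_monic A)) scale1r.
by rewrite big_map big_enum.
Qed.

Lemma diag_eigenvector (F : fieldType) (n : nat) (A P : 'M[F]_n) (d : 'rV_n) i :
  P \in unitmx -> A = invmx P *m diag_mx d *m P ->
  row i P *m A = d 0 i *: row i P.
Proof.
move=> Pu ->; rewrite -row_mul mulmxA mulmxA mulmxV // mul1mx.
by rewrite mul_diag_mx; apply/rowP=> j; rewrite !mxE.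
Qed.

(** A real symmetric matrix is normal, so the spectral theorem applies. *)
Lemma adjmx_spectral (g : sgraph) :
  exists P, exists2 d, P \in unitmx & adjmx g = invmx P *m diag_mx d *m P.
Proof.
exists (spectralmx (adjmx g)), (spectral_diag (adjmx g)).
  exact: spectral_unit.
apply/orthomx_spectralP/symmetric_normalmx.
- apply/is_hermitianmxP; rewrite expr0 scale1r map_mx_id //.
  by apply/matrixP=> i j; rewrite !mxE adj_sym.
- by apply/mxOverP=> i j; rewrite mxE realn.
Qed.

(** * Degrees and energies of regular graphs *)

(** Double counting of ordered adjacent pairs: by first component, and by underlying edge, where
    each fibre is [{(x, y), (y, x)}]. *)
Lemma handshake (g : sgraph) :
  (\sum_(x : vertex g) degree x = 2 * #|edges g|)%N.
Proof.
transitivity #|[set xy : vertex g * vertex g | adj xy.1 xy.2]|.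
  rewrite -sum1_card (eq_bigl (fun xy => true && adj xy.1 xy.2)); last first.
    by move=> xy; rewrite inE.
  rewrite -(pair_big_dep xpredT (fun x y => adj x y) (fun _ _ => 1%N)) /=.
  by apply: eq_bigr => x _; rewrite /degree -sum1_card;
    apply: eq_bigl => y; rewrite inE.
have -> : edges g = [set [set xy.1; xy.2]
    | xy in [set xy : vertex g * vertex g | adj xy.1 xy.2]].
  by apply/setP=> e; apply/imsetP/imsetP=> -[xy];
    rewrite ?inE => adj_xy ->; exists xy; rewrite ?inE.
rewrite -sum1_card (partition_big_imset (fun xy => [set xy.1; xy.2])) /=.
rewrite mulnC -sum_nat_const; apply: eq_bigr => e /imsetP[[x y]].
rewrite inE /= => xy ->; rewrite sum1_card.
have nxy : x != y by apply: contraTneq xy => ->; rewrite adj_irr.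
transitivity #|[set (x, y); (y, x)]|; last first.
  by rewrite cards2 xpair_eqE negb_and nxy.
apply: eq_card => -[u v]; rewrite unfold_in /= !inE /= !xpair_eqE.
apply/andP/orP => [[uv /eqP e_uv] | []/andP[/eqP-> /eqP->]].
- have nuv : u != v by apply: contraTneq uv => ->; rewrite adj_irr.
  have : u \in [set x; y] by rewrite -e_uv set21.
  have : v \in [set x; y] by rewrite -e_uv set22.
  rewrite !inE => /orP[]/eqP ev /orP[]/eqP eu;
    by move: nuv; rewrite ev eu !eqxx; auto.
- by [].
- by rewrite adj_sym setUC.
Qed.

Lemma regular_avg_degree (g : sgraph) (k : nat) :
  (forall x : vertex g, degree x = k) -> (0 < #|vertex g|)%N ->
  avg_degree g = k%:R.
Proof.
move=> deg_k n_gt0; rewrite /avg_degree -handshake.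
rewrite (eq_bigr (fun=> k)) // sum_nat_const natrM mulrC mulKf //.
by rewrite pnatr_eq0 -lt0n.
Qed.

Lemma regular_degmx (g : sgraph) (k : nat) :
  (forall x : vertex g, degree x = k) -> degmx g = k%:R%:M.
Proof.
move=> deg_k; rewrite -diag_const_mx; congr diag_mx.
by apply/rowP=> i; rewrite !mxE deg_k.
Qed.

(** The matrices [D + s A] share the diagonalization of [A], with entries [k + s d_i]; subtracting
    the average degree [k] leaves [|s d_i| = |d_i|] for [s = 1] and [s = -1]. *)
Lemma regular_energies (g : sgraph) (k : nat) :
  (forall x : vertex g, degree x = k) ->
  energy g = lap_energy g /\ lap_energy g = slap_energy g.
Proof.
move=> deg_k; have [P [d Pu defA]] := adjmx_spectral g.
have diagD s : degmx g + s *: adjmx g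
    = invmx P *m diag_mx (\row_i (k%:R + s * d 0 i)) *m P.
  have -> : diag_mx (\row_i (k%:R + s * d 0 i)) = k%:R%:M + s *: diag_mx d.
    by apply/matrixP=> i j; rewrite !mxE mulrnDl mulrnAr.
  rewrite (regular_degmx deg_k) mulmxDr mulmxDl -scalemxAr -scalemxAl -defA.
  by rewrite -mulmxA mul_scalar_mx -scalemxAr mulVmx // scalemx1.
(* The index [i] witnesses that there is a vertex; on the empty graph [avg_degree] is [0 / 0 = 0],
   whatever [k] is. *)
have avgE (i : 'I_#|vertex g|) : avg_degree g = k%:R.
  by apply: regular_avg_degree; last exact: leq_ltn_trans (ltn_ord i).
have EE : energy g = \sum_i `|d 0 i| by apply: sum_eigenvalues_diag Pu defA.
have LE : lap_energy g = \sum_i `|d 0 i|.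
  rewrite /lap_energy /lapmx -scaleN1r (sum_eigenvalues_diag _ Pu (diagD _)).
  by apply: eq_bigr => i _; rewrite mxE (avgE i) mulN1r addrC addKr normrN.
have QE : slap_energy g = \sum_i `|d 0 i|.
  rewrite /slap_energy /slapmx -[adjmx g]scale1r.
  rewrite (sum_eigenvalues_diag _ Pu (diagD _)).
  by apply: eq_bigr => i _; rewrite mxE (avgE i) mul1r addrC addKr.
by rewrite LE QE.
Qed.

(** * Energy of balanced complete multipartite graphs *)

(* The complete multipartite graphs with all parts of size m: the parts are
   the classes of the non-adjacency relation. *)
Definition equipartite (g : sgraph) (m : nat) :=
  (forall x y z : vertex g, ~~ adj x y -> ~~ adj y z -> ~~ adj x z)
  /\ (forall x : vertex g, #|[set y | ~~ adj x y]| = m).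

Lemma equipartite_degree (g : sgraph) (m : nat) :
  equipartite g m -> forall x : vertex g, degree x = (#|vertex g| - m)%N.
Proof.
move=> [_ part_m] x; rewrite -(part_m x) /degree cardsCs; congr (_ - _)%N.
by apply: eq_card => y; rewrite !inE.
Qed.

Lemma complete_equipartite (n : nat) : equipartite (complete_graph n) 1.
Proof.
split=> [x y z | x]; first by rewrite /= !negbK => /eqP-> /eqP->.
by rewrite -(cards1 x); apply: eq_card => y; rewrite !inE negbK eq_sym.
Qed.

(** Turns row sums of 0/1 matrices, indexed by ordinals, into counts of vertices. *)
Lemma sum_enum_val_nat (R : pzSemiRingType) (T : finType) (P : pred T) :
  \sum_(i < #|T|) (P (enum_val i))%:R = #|[set x | P x]|%:R :> R.
Proof.
rewrite -natr_sum; congr _%:R.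
rewrite -(big_enum_val (fun x : T => nat_of_bool (P x))).
by rewrite -sum1dep_card [RHS]big_mkcond /=; apply: eq_bigr => x _; case: (P x).
Qed.

Section Equipartite.
Variables (g : sgraph) (m : nat).
Hypothesis part_g : equipartite g m.

Let n := #|vertex g|.
Let J : 'M[algC]_n := const_mx 1.
Let A := adjmx g.

Let mulA_J : A *m J = (n - m)%:R *: J.
Proof.
apply/matrixP=> i j.
rewrite !mxE mulr1 -(equipartite_degree part_g (enum_val i)).
by rewrite -sum_enum_val_nat; apply: eq_bigr => k _; rewrite !mxE mulr1.
Qed.

Let mulJ_A : J *m A = (n - m)%:R *: J.
Proof.
apply/matrixP=> i j.
rewrite !mxE mulr1 -(equipartite_degree part_g (enum_val j)).
by rewrite -sum_enum_val_nat; apply: eq_bigr => k _; rewrite !mxE mul1r adj_sym.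
Qed.

Let adjmx_sqr : A *m A = (n - m)%:R *: J - m%:R *: A.
Proof.
have [adj_trans part_m] := part_g.
apply/matrixP=> i j.
have same_nbr (x y z : vertex g) : ~~ adj x y -> ~~ adj x z = ~~ adj y z :> bool.
  move=> xy; apply/idP/idP; last exact: adj_trans xy.
  by apply: adj_trans; rewrite adj_sym.
(* A = J - B with B the non-adjacency matrix, so A^2 = AJ - AB. *)
have -> : (A *m A) i j = (A *m J) i j -
    \sum_k A i k * (~~ adj (enum_val k) (enum_val j))%:R.
  rewrite !mxE -sumrB; apply: eq_bigr => k _; rewrite !mxE.
  by case: (adj (enum_val k) _); rewrite ?mulr1 ?mulr0 ?subr0 ?subrr.
rewrite mulA_J !mxE mulr1; congr (_ - _).
case: (boolP (adj (enum_val i) (enum_val j))) => adj_ij.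
(* Here [i] is adjacent to the whole part of [j], so the entry of [AB] counts that part. *)
- rewrite mulr1 -(part_m (enum_val j)) -sum_enum_val_nat; apply: eq_bigr => k _.
  rewrite mxE (adj_sym (enum_val k)).
  case: (boolP (adj (enum_val j) _)) => jk /=.
    by rewrite mulr0.
  have := same_nbr _ _ (enum_val i) jk.
  by rewrite !(adj_sym _ (enum_val i)) adj_ij mulr1 => /esym/negbFE->.
(* Here [i] and [j] share a part, which contains no neighbour of [i]. *)
- rewrite mulr0 big1 // => k _; have := same_nbr _ _ (enum_val k) adj_ij.
  rewrite mxE (adj_sym (enum_val k)) => <-.
  by case: (adj (enum_val i) _); rewrite /= ?mulr0 ?mul0r.
Qed.

Lemma equipartite_energy : energy g = (2 * (n - m))%:R.
Proof.
have [P [d Pu defA]] := adjmx_spectral g.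
rewrite /energy (sum_eigenvalues_diag _ Pu defA).
have [n0 | n_gt0] := posnP n.
  rewrite big1 => [|i _]; first by rewrite n0.
  by move: (ltn_ord i); rewrite -/n [in X in (_ < X)%N]n0.
have [x0 _] : exists x : vertex g, x \in vertex g by apply/card_gt0P.
have le_mn : (m <= n)%N by have [_ /(_ x0) <-] := part_g; exact: max_card.
have nE : n%:R = (n - m)%:R + m%:R :> algC by rewrite -natrD subnK.
set k : algC := (n - m)%:R in nE *.
have k_ge0 : 0 <= k by exact: ler0n.
have m_ge0 : 0 <= m%:R :> algC by exact: ler0n.
have n_neq0 : k + m%:R != 0 by rewrite -nE pnatr_eq0 -lt0n.
have eig i : [|| d 0 i == 0, d 0 i == - m%:R | d 0 i == k].
  have vA := diag_eigenvector i Pu defA; set v := row i P in vA.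
  have v_neq0 : v != 0.
    apply/eqP=> v0.
    have /rowP/(_ i)/eqP : v *m invmx P = 0 by rewrite v0 mul0mx.
    by rewrite -row_mul mulmxV // !mxE eqxx oner_eq0.
  (* The formula for [A^2] applied to the eigenvector [v]. A further product with [A] multiplies the
     left side by [l = d 0 i] and the right side by [k], whence [l (l + m) (l - k) = 0]. *)
  have vJ : (d 0 i * (d 0 i + m%:R)) *: v = k *: (v *m J).
    have := congr1 (mulmx v) adjmx_sqr; rewrite mulmxA vA -scalemxAl vA.
    rewrite mulmxBr -!scalemxAr vA => /eqP; rewrite eq_sym subr_eq => /eqP->.
    by rewrite !scalerA -scalerDl; congr (_ *: _); ring.
  have := congr1 (mulmxr A) vJ; rewrite /= -!scalemxAl vA -mulmxA mulJ_A.
  rewrite -scalemxAr -/k -vJ !scalerA -/v.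
  move/eqP; rewrite -subr_eq0 -scalerBl scaler_eq0 (negPf v_neq0) orbF.
  have -> : d 0 i * (d 0 i + m%:R) * d 0 i - k * (d 0 i * (d 0 i + m%:R))
     = d 0 i * ((d 0 i + m%:R) * (d 0 i - k)) by ring.
  by rewrite !mulf_eq0 subr_eq0 addr_eq0.
have tr1 : \sum_i d 0 i = 0.
  rewrite -mxtrace_diag.
  have -> : \tr (diag_mx d) = \tr A.
    by rewrite /A defA mxtrace_mulC mulmxA mulmxV // mul1mx.
  by rewrite /mxtrace big1 // => i _; rewrite mxE adj_irr.
have tr2 : \sum_i d 0 i ^+ 2 = n%:R * k.
  have -> : \sum_i d 0 i ^+ 2 = \tr (diag_mx d *m diag_mx d).
    by rewrite mulmx_diag mxtrace_diag; apply: eq_bigr => i _; rewrite mxE.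
  have -> : \tr (diag_mx d *m diag_mx d) = \tr (A *m A).
    have -> : A *m A = invmx P *m (diag_mx d *m diag_mx d) *m P.
      by rewrite /A defA -!mulmxA (mulmxA P (invmx P)) mulmxV // mul1mx.
    by rewrite [RHS]mxtrace_mulC !mulmxA mulmxV // mul1mx.
  rewrite [A *m A]adjmx_sqr linearB /= !linearZ /= -/k.
  rewrite /mxtrace [X in _ * X - _](eq_bigr (fun=> 1)) => [|i _]; last first.
    by rewrite mxE.
  rewrite sumr_const card_ord [X in _ - _ * X]big1 => [|i _]; last first.
    by rewrite mxE adj_irr.
  by rewrite mulr0 subr0 mulrC.
(* b is chosen so that |l| = (1 - b k) l + b l^2 at l = 0, -m and k. *)
pose b : algC := 2 / (k + m%:R).
rewrite (eq_bigr (fun i => (1 - b * k) * d 0 i + b * d 0 i ^+ 2)) => [|i _].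
  (* The linear term vanishes with the trace, and the quadratic one gives [b n k = 2 k]. *)
  rewrite big_split /= -!mulr_sumr tr1 tr2 nE natrM -/k /b.
  by field.
rewrite /b; case/or3P: (eig i) => /eqP->.
- by rewrite normr0 mulr0 expr0n mulr0 addr0.
- by rewrite normrN (ger0_norm m_ge0); field.
- by rewrite (ger0_norm k_ge0); field.
Qed.

End Equipartite.

(** * Groups whose central quotient has order [p^2] *)

Section PrimeSquareCentralQuotient.
Variables (p : nat) (gT : finGroupType) (G : {group gT}).
Hypotheses (p_prime : prime p) (card_quo : #|(G / 'Z(G))%g| = (p ^ 2)%N).

Let indexZ : #|G : 'Z(G)| = (p ^ 2)%N.
Proof. by rewrite -card_quo card_quotient // normal_norm ?center_normal. Qed.

Let center_sub_cent1 x : x \in G -> 'Z(G) \subset 'C_G[x].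
Proof.
move=> Gx; rewrite subsetI center_sub /= sub_cent1.
by apply: subsetP Gx; rewrite centsC subsetIr.
Qed.

(** The index divides [p^2]. It is not 1, since [x] is a noncentral element of its centralizer, and
    not [p^2], since then [x] would commute with all of [G]. *)
Lemma index_center_cent1 x : x \in G :\: 'Z(G) -> #|'C_G[x] : 'Z(G)| = p.
Proof.
case/setDP=> Gx nZx; have sZC := center_sub_cent1 Gx.
have sCG : 'C_G[x] \subset G by apply: subsetIl.
have := Lagrange_index sCG sZC; rewrite indexZ => index_mul.
have /(dvdn_pfactor _ _ p_prime)[e le_e2 def_e]
    : (#|'C_G[x] : 'Z(G)| %| p ^ 2)%N.
  by rewrite -index_mul dvdn_mull.
(* The exponents are treated in the order 1, 2, 0. *)
case: e le_e2 def_e => [|[|[|//]]] _ def_e; last 2 first.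
- by rewrite def_e expn1.
- move/eqP: index_mul; rewrite def_e -[X in _ == X]mul1n.
  rewrite eqn_pmul2r ?expn_gt0 ?prime_gt0 //.
  rewrite indexg_eq1 => sGC; case/negP: nZx; apply/centerP; split=> // y Gy.
  by have /setIP[_ /cent1P] := subsetP sGC y Gy.
- move/eqP: def_e; rewrite indexg_eq1 => sCZ; case/negP: nZx.
  by rewrite (subsetP sCZ) // inE Gx cent1id.
Qed.

(** [Z(G)] is central in the centralizer with quotient of prime order, hence cyclic, and a group
    with a cyclic central quotient is abelian. *)
Lemma abelian_cent1 x : x \in G :\: 'Z(G) -> abelian 'C_G[x].
Proof.
move=> GZx; have [Gx _] := setDP GZx; have sZC := center_sub_cent1 Gx.
have sCG : 'C_G[x] \subset G by apply: subsetIl.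
apply: (@cyclic_factor_abelian _ 'Z(G)).
  by rewrite subsetI sZC; apply: subset_trans (subsetIr _ _) (centS sCG).
apply: prime_cyclic; rewrite card_quotient ?index_center_cent1 //.
by rewrite (subset_trans sCG) // normal_norm ?center_normal.
Qed.

(** If [x] and [z] commute with [y], both lie in the abelian group ['C_G[y]]. The part of [x] is
    ['C_G[x]] minus [Z(G)], of size [p |Z(G)| - |Z(G)|]. *)
Lemma noncommuting_equipartite :
  equipartite (noncommuting_graph G) ((p - 1) * #|'Z(G)|).
Proof.
split=> [[x GZx] [y GZy] [z GZz] | [x GZx]].
  rewrite /= /noncomm_rel !negbK /= => /eqP xy /eqP yz.
  have [[Gx _] [Gz _]] := (setDP GZx, setDP GZz).
  apply/eqP; apply: (centsP (abelian_cent1 GZy)).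
    by rewrite inE Gx; apply/cent1P.
  by rewrite inE Gz; apply/cent1P.
have [Gx _] := setDP GZx; have sZC := center_sub_cent1 Gx.
transitivity #|'C_G[x] :\: 'Z(G)|.
  rewrite -(card_imset _ val_inj); apply: eq_card => y.
  apply/imsetP/idP => [[[u GZu]] | ].
    rewrite inE negbK /noncomm_rel /= => /eqP xu ->.
    have [Gu nZu] := setDP GZu.
    by rewrite !in_setD nZu in_setI Gu; apply/cent1P.
  rewrite in_setD => /andP[nZy /setIP[Gy /cent1P xy]].
  have GZy : y \in G :\: 'Z(G) by rewrite inE nZy.
  by exists (Sub y GZy) => //; rewrite inE negbK /noncomm_rel /= xy.
rewrite cardsD (setIidPr sZC) -(Lagrange sZC) index_center_cent1 //.
by rewrite mulnC mulnBl mul1n.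
Qed.

Lemma card_noncentral :
  #|noncentral G| = (p.+1 * ((p - 1) * #|'Z(G)|))%N.
Proof.
rewrite card_sig cardsD (setIidPr (center_sub G)).
rewrite -(Lagrange (center_sub G)) indexZ mulnA mulnC.
(* The factor [p^2 - 1] is written as [p^2 - 1^2] to split it as a difference of squares. *)
rewrite -[X in (_ - X)%N]mul1n -mulnBl -(exp1n 2) subn_sqr addn1.
by rewrite [(_ * p.+1)%N]mulnC.
Qed.

Lemma noncommuting_graph_energies :
  let g := noncommuting_graph G in
  [/\ energy g = lap_energy g, lap_energy g = slap_energy g
    & [/\ ~ hypoenergetic g, ~ hyperenergetic g,
          ~ L_hyperenergetic g & ~ Q_hyperenergetic g]].
Proof.
move=> g; pose m := ((p - 1) * #|'Z(G)|)%N; pose n := #|vertex g|.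
have part_g : equipartite g m := noncommuting_equipartite.
have part_K := complete_equipartite n.
have m_gt0 : (0 < m)%N by rewrite muln_gt0 subn_gt0 prime_gt1 ?cardG_gt0.
have nE : n = (p.+1 * m)%N := card_noncentral.
have [E_LE LE_QE] := regular_energies (equipartite_degree part_g).
have [EK_LEK LEK_QEK] := regular_energies (equipartite_degree part_K).
have E_le_EK : energy g <= energy (complete_graph n).
  (* The comparison is [2 (n - m) <= 2 (n - 1)], which holds as [m] is positive. *)
  rewrite (equipartite_energy part_g) (equipartite_energy part_K) /= card_ord.
  by rewrite ler_nat leq_mul2l leq_sub2l.
have not_hyper := le_gtF E_le_EK.
split; [exact: E_LE | exact: LE_QE | split].
- rewrite /hypoenergetic (equipartite_energy part_g) ltr_nat.
  (* With [n = m + p m] the energy is [p m + p m], so the claim reduces to [m <= p m]. *)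
  apply/negP; rewrite -leqNgt -/n nE mulSn addKn mul2n -addnn leq_add2r.
  by rewrite leq_pmull ?prime_gt0.
- by rewrite /hyperenergetic not_hyper.
- by rewrite /L_hyperenergetic -E_LE -EK_LEK not_hyper.
- by rewrite /Q_hyperenergetic -LE_QE -LEK_QEK -E_LE -EK_LEK not_hyper.
Qed.

End PrimeSquareCentralQuotient.

(** * Non-abelian groups of order [p^3] and the theorem *)

(** Let [|Z(G)| = p^e]. A nontrivial [p]-group has nontrivial center, which excludes [e = 0]; for
    [e = 2] or [3] the central quotient is cyclic, which would make [G] abelian. Only [e = 1]
    remains. *)
Lemma card_center_quotient_p3 (p : nat) (gT : finGroupType) (G : {group gT}) :
  prime p -> ~~ abelian G -> #|G| = (p ^ 3)%N -> #|(G / 'Z(G))%g| = (p ^ 2)%N.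
Proof.
move=> p_prime nabG cardG; have p_gt0 := prime_gt0 p_prime.
have pG : p.-group G by rewrite /pgroup cardG pnatX pnat_id.
have ntG : G :!=: 1%g by apply: contraNneq nabG => ->; exact: abelian1.
have /(dvdn_pfactor _ _ p_prime)[e le_e2 cardZ] : (#|'Z(G)| %| p ^ 3)%N.
  by rewrite -cardG cardSg ?center_sub.
have cardQ : #|(G / 'Z(G))%g| = (p ^ (3 - e))%N.
  rewrite card_quotient ?normal_norm ?center_normal //.
  by rewrite -divgS ?center_sub // cardG cardZ expnB.
have ncycQ : ~~ cyclic (G / 'Z(G))%g.
  by apply: contra nabG; exact: cyclic_center_factor_abelian.
case: e le_e2 cardZ cardQ => [|[|[|[|//]]]] _ cardZ cardQ //.
- case/negP: ntG; rewrite -(center_nil_eq1 (pgroup_nil pG)).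
  by rewrite trivg_card1 cardZ.
- by case/negP: ncycQ; apply: prime_cyclic; rewrite cardQ expn1.
- case/negP: ncycQ; have -> : (G / 'Z(G))%g = 1%g by apply/card1_trivg.
  exact: cyclic1.
Qed.

Theorem theorem3p3 (p : nat) (p_prime : prime p) :
  (forall (gT : finGroupType) (G : {group gT}),
     (G / 'Z(G))%g \isog [set: 'Z_p * 'Z_p] ->
     [/\ energy (noncommuting_graph G) = lap_energy (noncommuting_graph G),
         lap_energy (noncommuting_graph G) = slap_energy (noncommuting_graph G)
       & [/\ ~ hypoenergetic (noncommuting_graph G),
             ~ hyperenergetic (noncommuting_graph G),
             ~ L_hyperenergetic (noncommuting_graph G)
           & ~ Q_hyperenergetic (noncommuting_graph G)]])
  /\
  (forall (gT : finGroupType) (G : {group gT}),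
     ~~ abelian G -> #|G| = (p ^ 3)%N ->
     [/\ energy (noncommuting_graph G) = lap_energy (noncommuting_graph G),
         lap_energy (noncommuting_graph G) = slap_energy (noncommuting_graph G)
       & [/\ ~ hyperenergetic (noncommuting_graph G),
             ~ hypoenergetic (noncommuting_graph G),
             ~ L_hyperenergetic (noncommuting_graph G)
           & ~ Q_hyperenergetic (noncommuting_graph G)]]).
Proof.
split=> gT G => [isoG | nabG cardG].
  apply: (noncommuting_graph_energies p_prime); rewrite (card_isog isoG).
  (* The type ['Z_p] has [p] elements only for [p > 1], which primality provides. *)
  by rewrite cardsT card_prod card_ord Zp_cast ?prime_gt1.
have cardQ := card_center_quotient_p3 p_prime nabG cardG.
have [E_LE LE_QE [hypo hyper Lhyper Qhyper]] :=
  noncommuting_graph_energies p_prime cardQ.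
exact: And3 E_LE LE_QE (And4 hyper hypo Lhyper Qhyper).
Qed.
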